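(* Let $P \subset \mathbb{R}^d$ be a compact convex set of diameter $D = \sup_{x,y\in P}\|x-y\|$, and let $V(P)\subset P$ satisfy $P = \mathrm{conv}(V(P))$. Let $f:\mathbb{R}^d\to\mathbb{R}$ be a differentiable function that is convex and $L$-smooth, and let $x^\ast$ be a minimizer of $f$ over $P$. Let $T\ge 1$ and let $\{x_i\}_{i=0}^T\subset P$ be a sequence generated by the Blended Pairwise Conditional Gradients (BPCG) algorithm (described in the context) started at some $x_0\in V(P)$. Then $$f(x_T)-f(x^\ast)\le \frac{4LD^2}{T}.$$
   Context: $\langle\cdot,\cdot\rangle$ and $\|\cdot\|$ are the Euclidean inner product and norm. A differentiable $f$ is $L$-smooth if $f(y)-f(x)-\langle\nabla f(x),y-x\rangle\le\frac L2\|y-x\|^2$ for all $x,y\in\mathbb{R}^d$. BPCG algorithm. It maintains iterates $x_t\in P$, finite active sets $S_t\subset V(P)$ and an explicit convex combination $x_t=\sum_{v\in S_t}c[x_t](v)\,v$ (nonnegative weights $c[x_t](v)$ summing to $1$). Start: $x_0\in V(P)$, $S_0=\{x_0\}$, $c[x_0](x_0)=1$. For $t=0,1,\dots,T-1$: - choose $a_t\in\mathrm{argmax}_{v\in S_t}\langle\nabla f(x_t),v\rangle$, $s_t\in\mathrm{argmin}_{v\in S_t}\langle\nabla f(x_t),v\rangle$, $w_t\in\mathrm{argmin}_{v\in V(P)}\langle\nabla f(x_t),v\rangle$ (the last minimum is assumed to be attained); - if $\langle\nabla f(x_t),a_t-s_t\rangle\ge\langle\nabla f(x_t),x_t-w_t\rangle$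 (pairwise step): set $d_t=a_t-s_t$, $\Lambda_t^\ast=c[x_t](a_t)$, choose $\lambda_t\in\mathrm{argmin}_{\lambda\in[0,\Lambda_t^\ast]}f(x_t-\lambda d_t)$; if $\lambda_t<\Lambda_t^\ast$ set $S_{t+1}=S_t$ (descent step), otherwise set $S_{t+1}=S_t\setminus\{a_t\}$ (drop step); - otherwise (FW step): set $d_t=x_t-w_t$, choose $\lambda_t\in\mathrm{argmin}_{\lambda\in[0,1]}f(x_t-\lambda d_t)$, and set $S_{t+1}=S_t\cup\{w_t\}$ (or $S_{t+1}=\{w_t\}$ if $\lambda_t=1$); - in all cases set $x_{t+1}=x_t-\lambda_t d_t$, with weights updated accordingly (pairwise step: move weight $\lambda_t$ from $a_t$ to $s_t$; FW step: multiply all weights by $1-\lambda_t$ and add $\lambda_t$ to the weight of $w_t$). *)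

(* Defs.v *)
From HB Require Import structures.
From mathcomp Require Import all_boot all_order all_algebra finmap.
From mathcomp Require Import all_classical all_reals all_analysis.

Set Implicit Arguments.
Unset Strict Implicit.
Unset Printing Implicit Defensive.

Import Order.TTheory GRing.Theory Num.Theory.
Import numFieldNormedType.Exports.

Local Open Scope classical_set_scope.
Local Open Scope fset_scope.
Local Open Scope ring_scope.

(* R^d is 'rV[R]_d. The norm `|x| that the library puts on matrices is the
   sup norm; it induces the usual topology, so it is the right one for
   [compact] and [differentiable], but metric quantities use [enorm]. *)

Section Euclidean.
Context {R : realType} {d : nat}.
Implicit Types (x y : 'rV[R]_d) (P V : set 'rV[R]_d) (f : 'rV[R]_d -> R).

Definition dot x y : R := \sum_(i < d) x 0 i * y 0 i.

Definition enorm x : R := Num.sqrt (dot x x).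

Definition diameter P : R := sup [set enorm (x - y) | x in P & y in P].

Definition convex_hull V : set 'rV[R]_d :=
  smallest (@convex_set R 'rV[R]_d) V.

(* Meaningful when f is differentiable at x; the i-th entry is the partial
   derivative along the i-th vector of the canonical basis. *)
Definition gradient f x : 'rV[R]_d := \row_(i < d) 'D_(delta_mx 0 i) f x.

Definition smooth_with (L : R) f :=
  forall x y,
    f y - f x - dot (gradient f x) (y - x) <= L / 2 * enorm (y - x) ^+ 2.

End Euclidean.

Definition argmin_set {R : realType} {T : Type} (A : set T) (phi : T -> R) :=
  [set a | A a /\ forall b, A b -> phi a <= phi b].

Definition argmax_set {R : realType} {T : Type} (A : set T) (phi : T -> R) :=
  [set a | A a /\ forall b, A b -> phi b <= phi a].

Section BPCG.
Context {R : realType} {d : nat}.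
Notation E := 'rV[R]_d.
Implicit Types (V : set E) (f : E -> R) (x a s w : E) (S : {fset E})
  (c : E -> R) (lambda : R).

(* A state is an iterate x, an active set S and a weight function c, which is
   total on R^d and starts out as zero off S, so that a vertex entering S has
   weight zero before it receives its share. *)

Definition pairwise_step f a s x S c x' S' c' :=
  let dir := a - s in
  let lambda_max := c a in
  exists lambda,
    [/\ argmin_set `[0, lambda_max] (fun l : R => f (x - l *: dir)) lambda,
        x' = x - lambda *: dir,
        S' = (if lambda < lambda_max then S else S `\ a) &
        c' = (fun v => c v - lambda * (v == a)%:R + lambda * (v == s)%:R)].

Definition fw_step f w x S c x' S' c' :=
  let dir := x - w in
  exists lambda,
    [/\ argmin_set `[0, 1] (fun l : R => f (x - l *: dir)) lambda,
        x' = x - lambda *: dir,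
        S' = (if lambda == 1 then [fset w] else w |` S) &
        c' = (fun v => (1 - lambda) * c v + lambda * (v == w)%:R)].

Definition bpcg_step V f x S c x' S' c' :=
  let g := gradient f x in
  exists a s w,
    [/\ argmax_set [set` S] (dot g) a,
        argmin_set [set` S] (dot g) s,
        argmin_set V (dot g) w &
        if dot g (a - s) >= dot g (x - w)
        then pairwise_step f a s x S c x' S' c'
        else fw_step f w x S c x' S' c'].

Definition bpcg_run V f (T : nat)
    (x : nat -> E) (S : nat -> {fset E}) (c : nat -> E -> R) :=
  [/\ V (x 0%N),
      S 0%N = [fset x 0%N],
      c 0%N = (fun v => (v == x 0%N)%:R) &
      forall t, (t < T)%N ->
        bpcg_step V f (x t) (S t) (c t) (x t.+1) (S t.+1) (c t.+1)].

End BPCG.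

(* Main.v *)
Require Import Defs.
From HB Require Import structures.
From mathcomp Require Import all_boot all_order all_algebra finmap.
From mathcomp Require Import all_classical all_reals all_analysis.
From mathcomp Require Import zify ring lra.

Set Implicit Arguments.
Unset Strict Implicit.
Unset Printing Implicit Defensive.

Import Order.TTheory GRing.Theory Num.Theory.
Import numFieldNormedType.Exports.

Local Open Scope classical_set_scope.
Local Open Scope ring_scope.

(** Write C for L D^2, D the diameter of P, h_t for the gap f(x_t) - f(xstar)
    and g for the gradient at x_t.

    Whichever branch is taken, the chosen direction d_t satisfies
    h_t <= <g, d_t>: convexity and the minimality of w_t over V, hence over its
    hull P, give h_t <= <g, x_t - w_t>, and a pairwise direction is only
    preferred when its slope is at least as large. Both endpoints of d_t lie
    in P, so smoothness bounds f(x_t - l d_t) - f(xstar) by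
    (1 - l) h_t + l^2 C / 2. The exact line search inherits this bound for all
    l in [0, 1] in every step that is not a drop step
    ([bpcg_step_progress]): a Frank-Wolfe step searches all of [0, 1], and in a
    descent step the minimum is attained before the right end of the search
    interval, so by convexity it is a minimum over the whole ray
    ([interior_line_search_ray]).

    A drop step guarantees nothing beyond h_{t+1} <= h_t, but it removes a
    vertex from the active set. So the quantity n_t = t + |S_t| is unchanged by
    a drop step and increases by at most 2 in any other step, and the invariant

      (n_t + 5) h_t <= 4 C     for t >= 1

    pays for all drop steps at once. A drop step preserves it trivially; in any
    other step, with m = n_t + 5, the choice l = 4 / m turns h_t <= 4 C / m into
    h_{t+1} <= 4 C / (m + 2) ([harmonic_recurrence]). It holds at t = 1 because
    l = 1 gives h_1 <= C / 2 while |S_1| <= 2; a drop from the singleton S_0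
    would have a_0 = s_0, which forces h_0 = 0. Since n_T >= T, the theorem
    follows. The offset 5 makes m >= 4, so that l = 4 / m is at most 1, and
    keeps m <= 8 at t = 1. *)

(** * Euclidean geometry of row vectors *)

Section EuclideanFacts.
Context {R : realType} {d : nat}.
Implicit Types (u v w x y z g : 'rV[R]_d) (P V : set 'rV[R]_d).

Lemma dotDr g u v : dot g (u + v) = dot g u + dot g v.
Proof. by rewrite -big_split; apply: eq_bigr => i _; rewrite mxE mulrDr. Qed.

Lemma dotZr g (l : R) u : dot g (l *: u) = l * dot g u.
Proof. by rewrite mulr_sumr; apply: eq_bigr => i _; rewrite mxE mulrCA. Qed.

Lemma dotNr g u : dot g (- u) = - dot g u.
Proof. by rewrite -scaleN1r dotZr mulN1r. Qed.

Lemma dotBr g u v : dot g (u - v) = dot g u - dot g v.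
Proof. by rewrite dotDr dotNr. Qed.

Lemma dot_ge0 u : 0 <= dot u u.
Proof. by apply: sumr_ge0 => i _; rewrite -expr2 sqr_ge0. Qed.

Lemma enorm_ge0 u : 0 <= enorm u.
Proof. exact: sqrtr_ge0. Qed.

Lemma enorm_sqr u : enorm u ^+ 2 = dot u u.
Proof. by rewrite sqr_sqrtr ?dot_ge0. Qed.

Lemma enormZ_sqr (l : R) u : enorm (l *: u) ^+ 2 = l ^+ 2 * enorm u ^+ 2.
Proof.
rewrite !enorm_sqr dotZr !mulr_sumr; apply: eq_bigr => i _.
by rewrite mxE; ring.
Qed.

Lemma coord_le_norm u i : `|u 0 i| <= `|u|.
Proof.
rewrite [leRHS]mx_normrE.
exact: (le_bigmax _ (fun ij : 'I_1 * 'I_d => `|u ij.1 ij.2|) (0, i)).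
Qed.

(** Compares the Euclidean norm with the sup norm, in which compactness of P
    yields boundedness. *)
Lemma enorm_le_norm u : enorm u <= Num.sqrt (d%:R * `|u| ^+ 2).
Proof.
apply: ler_wsqrtr; rewrite mulr_natl.
rewrite -[X in _ *+ X]card_ord -sumr_const; apply: ler_sum => i _.
rewrite -expr2 -real_normK ?num_real// ler_sqr ?nnegrE//.
exact: coord_le_norm.
Qed.

(** The diameter is a supremum in R, meaningful only for a bounded set of
    distances: this is where compactness enters. *)
Lemma enorm_le_diameter P x y :
  compact P -> P x -> P y -> enorm (x - y) <= diameter P.
Proof.
move=> /compact_bounded[M [_ PM]] Px Py.
have {}PM z : P z -> `|z| <= M + 1 by apply: PM; rewrite ltrDl.
apply: ub_le_sup; last by exists x => //; exists y.
exists (Num.sqrt (d%:R * (M + 1 + (M + 1)) ^+ 2)) => _ [u Pu [v Pv <-]].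
apply: le_trans (enorm_le_norm _) _; apply: ler_wsqrtr.
rewrite ler_wpM2l// ler_sqr ?nnegrE//.
- by rewrite (le_trans (ler_normB _ _))// lerD ?PM.
- have M0 : 0 <= M + 1 by exact: le_trans (normr_ge0 u) (PM _ Pu).
  by rewrite addr_ge0.
Qed.

(** The half-space of the u with <g, w> <= <g, u> is convex and contains V. *)
Lemma argmin_dot_convex_hull V g w z :
  argmin_set V (dot g) w -> convex_hull V z -> dot g w <= dot g z.
Proof.
move=> [Vw wmin] /(_ [set u | dot g w <= dot g u]); apply.
split=> [x y l|v]; last exact: wmin.
rewrite !inE /= => wx wy.
rewrite dotDr !dotZr.
have l0 : 0 <= l%:num by exact: ge0.
have l1 : l%:num <= 1 by exact: le1.
rewrite -[unstable.onem _]/(1 - l%:num); nra.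
Qed.

End EuclideanFacts.

(** * Smooth convex functions *)

Section SmoothConvex.
Context {R : realType} {d : nat}.
Implicit Types (u v x y : 'rV[R]_d) (P : set 'rV[R]_d) (f : 'rV[R]_d -> R).

Lemma convex_function_segment f x y (t : R) :
  convex_function [set: 'rV[R]_d] f -> 0 <= t -> t <= 1 ->
  f (t *: x + (1 - t) *: y) <= t * f x + (1 - t) * f y.
Proof. by move=> cf t0 t1; apply: (cf (Itv01 t0 t1)); rewrite inE. Qed.

Lemma derive_gradient f x v :
  differentiable f x -> 'D_v f x = dot (gradient f x) v.
Proof.
move=> df; rewrite deriveE// {1}(row_sum_delta v) linear_sum.
apply: eq_bigr => i _; rewrite linearZ /= mxE -deriveE//.
by rewrite mulrC.
Qed.

(** The difference quotients of f at x towards y, with positive step at most 1,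
    are at most the increment f y - f x of f along the chord; pass to the limit
    from the right. *)
Lemma convex_first_order f x y :
  convex_function [set: 'rV[R]_d] f -> differentiable f x ->
  dot (gradient f x) (y - x) <= f y - f x.
Proof.
move=> cf df; rewrite -derive_gradient//.
have cv : derivable f x (y - x) by exact: diff_derivable.
apply: (cvgr_to_le (cvg_dnbhs_at_right cv)).
near=> h.
have h0 : 0 < h by near: h; exact: nbhs_right_gt.
have h1 : h <= 1 by near: h; apply: nbhs_right_le.
rewrite /= -[_ *: _]/(_ * _) mulrC ler_pdivrMr//.
have := @convex_function_segment f y x h cf (ltW h0) h1.
rewrite (_ : h *: (y - x) + x = h *: y + (1 - h) *: x); last first.
  by rewrite scalerBr scalerBl scale1r addrAC addrA.
lra.
Unshelve. all: by end_near. Qed.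

(** Convexity bounds from below the same remainder that smoothness bounds from
    above; so L >= 0 unless the space is a point. *)
Lemma smooth_convex_enorm L f u :
  convex_function [set: 'rV[R]_d] f -> (forall y, differentiable f y) ->
  smooth_with L f -> 0 <= L * enorm u ^+ 2.
Proof.
move=> cf df /(_ 0 u); have := @convex_first_order f 0 u cf (df 0).
by rewrite subr0; lra.
Qed.

(** Monotonicity in the norm when 0 <= L; a negative L is only possible in
    dimension zero, where both sides vanish. *)
Lemma smooth_diameter_bound L f P x y :
  convex_function [set: 'rV[R]_d] f -> (forall y, differentiable f y) ->
  smooth_with L f -> compact P -> P x -> P y ->
  L * enorm (x - y) ^+ 2 <= L * diameter P ^+ 2.
Proof.
move=> cf df sf cP Px Py.
have [L0|L0] := leP 0 L.
  by rewrite ler_wpM2l// ler_sqr ?nnegrE ?enorm_ge0 ?enorm_le_diameter//;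
    exact: le_trans (enorm_ge0 _) (enorm_le_diameter cP Px Py).
have enorm_eq0 u : enorm u = 0.
  have := smooth_convex_enorm u cf df sf.
  rewrite nmulr_rge0// => u0; apply/eqP.
  by rewrite -sqrf_eq0 eq_le u0 sqr_ge0.
have -> : diameter P = 0.
  rewrite /diameter -[RHS]sup1; congr sup.
  apply/seteqP; split=> [_ [u _ [v _ <-]]|_ ->]; first by rewrite enorm_eq0.
  by exists x => //; exists x => //; rewrite enorm_eq0.
by rewrite enorm_eq0.
Qed.

Lemma smooth_descent L f x v (l : R) :
  smooth_with L f ->
  f (x - l *: v) <=
    f x - l * dot (gradient f x) v + l ^+ 2 / 2 * (L * enorm v ^+ 2).
Proof.
move=> /(_ x (x - l *: v)).
have -> : x - l *: v - x = - l *: v by rewrite addrAC subrr add0r scaleNr.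
rewrite dotZr enormZ_sqr sqrrN.
lra.
Qed.

(** Past lmax, convexity takes over: lmax is a convex combination of lt and l,
    and f is no smaller at lmax than at lt, hence no smaller at l either. *)
Lemma interior_line_search_ray f x v (lmax lt l : R) :
  convex_function [set: 'rV[R]_d] f ->
  argmin_set `[0, lmax] (fun l : R => f (x - l *: v)) lt -> lt < lmax ->
  0 <= l -> f (x - lt *: v) <= f (x - l *: v).
Proof.
move=> cf [/=]; rewrite in_itv/= => /andP[lt0 _] ltmin ltlmax l0.
have [llmax|lmaxl] := leP l lmax; first by apply: ltmin; rewrite /= in_itv/= l0.
have dlt : 0 < l - lt by rewrite subr_gt0 (lt_trans ltlmax).
pose p := (lmax - lt) / (l - lt).
have pE : p * (l - lt) = lmax - lt by rewrite divfK ?gt_eqF.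
have p0 : 0 < p by rewrite divr_gt0// subr_gt0.
have p1 : p <= 1 by rewrite ler_pdivrMr// mul1r lerD2r ltW.
have := ltmin lmax; rewrite /= in_itv/= lexx (le_trans lt0 (ltW ltlmax)).
move=> /(_ isT).
have -> : x - lmax *: v = p *: (x - l *: v) + (1 - p) *: (x - lt *: v).
  apply/rowP => i; rewrite !mxE; have -> : lmax = p * (l - lt) + lt by lra.
  ring.
have := @convex_function_segment f (x - l *: v) (x - lt *: v) p cf (ltW p0) p1.
nra.
Qed.

End SmoothConvex.

(** * Progress of one step *)

(** The O(1/t) rate of a gap h obeying h' <= (1 - l) h + l^2 C / 2 for every l
    in [0, 1]. If h = 4 C / m, the value l = 4 / m minimizes the right-hand
    side; unlike l = h / C, it makes sense for C = 0. *)
Lemma harmonic_recurrence (R : realFieldType) (C m m' h h' : R) :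
  4 <= m -> m' <= m + 2 -> 0 <= h' -> m * h <= 4 * C ->
  h' <= (1 - 4 / m) * h + (4 / m) ^+ 2 / 2 * C -> m' * h' <= 4 * C.
Proof.
move=> m4 m'm h'0 mh h'h.
have m0 : 0 < m by lra.
have mm0 : 0 < m ^+ 2 by rewrite exprn_gt0.
(* Since (m + 2) (m - 2) <= m^2, this bound yields the claim. *)
have h'm : h' * m ^+ 2 <= 4 * C * (m - 2).
  have : h' * m ^+ 2 <= (m - 4) * (m * h) + 8 * C.
    apply: le_trans (ler_wpM2r (ltW mm0) h'h) _.
    by rewrite le_eqVlt; apply/orP; left; apply/eqP; field; rewrite gt_eqF.
  by nra.
have C0 : 0 <= C.
  have : 0 <= 4 * C * (m - 2) by rewrite (le_trans _ h'm)// mulr_ge0// ltW.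
  by rewrite pmulr_lge0; lra.
rewrite -(ler_pM2r mm0).
have : m' * (h' * m ^+ 2) <= (m + 2) * (4 * C * (m - 2)).
  apply: (le_trans (ler_wpM2r _ m'm)); first by rewrite mulr_ge0// ltW.
  by apply: ler_wpM2l => //; lra.
nra.
Qed.

Section BPCGProgress.
Context {R : realType} {d : nat}.
Variables (P V : set 'rV[R]_d) (f : 'rV[R]_d -> R) (L : R) (xstar : 'rV[R]_d).
Hypotheses (P_compact : compact P) (V_sub_P : V `<=` P)
  (P_hull : P = convex_hull V) (f_diff : forall y, differentiable f y)
  (f_convex : convex_function [set: 'rV[R]_d] f) (f_smooth : smooth_with L f)
  (xstar_min : argmin_set P f xstar).
Implicit Types (v w x : 'rV[R]_d) (S : {fset 'rV[R]_d}) (c : 'rV[R]_d -> R).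

Let C := L * diameter P ^+ 2.
Let gap x := f x - f xstar.

(** The guarantee of an exact line search from x to x' along a direction of
    slope at least [gap x] between two points of P. *)
Definition quadratic_progress x x' :=
  forall l, 0 <= l -> l <= 1 -> gap x' <= (1 - l) * gap x + l ^+ 2 / 2 * C.

(** The Frank-Wolfe gap dominates the primal gap: a linear function minimized
    over V at w is minimized over P at w, so it is no larger there than at
    xstar. *)
Lemma gap_le_fw_gap x w :
  P x -> argmin_set V (dot (gradient f x)) w ->
  gap x <= dot (gradient f x) (x - w).
Proof.
move=> Px wmin; have Pxstar : P xstar by case: xstar_min.
have := convex_first_order xstar f_convex (f_diff x).
have := @argmin_dot_convex_hull _ _ V _ w xstar wmin.
rewrite -P_hull => /(_ Pxstar); rewrite !dotBr /gap; lra.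
Qed.

Lemma quadratic_progressP x x' u v :
  P u -> P v -> gap x <= dot (gradient f x) (u - v) ->
  (forall l, 0 <= l -> l <= 1 -> f x' <= f (x - l *: (u - v))) ->
  quadratic_progress x x'.
Proof.
move=> Pu Pv gapx fx' l l0 l1.
have := fx' l l0 l1; have := smooth_descent x (u - v) l f_smooth.
have := smooth_diameter_bound f_convex f_diff f_smooth P_compact Pu Pv.
rewrite -/C => E.
have := ler_wpM2l l0 gapx.
have : 0 <= l ^+ 2 / 2 by rewrite divr_ge0// sqr_ge0.
move=> /ler_wpM2l /(_ _ _ E); rewrite /gap; lra.
Qed.

(** The dichotomy behind the rate: either the step makes quadratic progress and
    the active set gains at most one vertex, or it is a drop step, which loses
    a vertex and does not increase f. The last clause of the drop case serves
    the first iteration: a drop from a singleton has zero slope, hence occurs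
    only at a minimizer. *)
Lemma bpcg_step_progress x S c x' S' c' :
  P x -> [set` S] `<=` V -> bpcg_step V f x S c x' S' c' ->
  [set` S'] `<=` V /\
  ((#|` S'| <= #|` S| + 1)%N /\ quadratic_progress x x' \/
   [/\ (#|` S'| + 1 = #|` S|)%N, f x' <= f x &
       (#|` S| <= 1)%N -> gap x <= 0]).
Proof.
move=> Px SV [a [s [w [[/= aS _] [/= sS _] wmin]]]].
have Vw : V w by case: wmin.
have gapx := gap_le_fw_gap Px wmin.
case: ifPn => [pw|_] [lt [lmin -> -> _]].
  have gapas := le_trans gapx pw.
  have [ltlmax|lmaxlt] := ltP lt (c a).
    split=> //; left; split; first by rewrite leq_addr.
    apply: (@quadratic_progressP x _ a s) => //; do ?exact/V_sub_P/SV.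
    (* Descent step: the minimizer is not at the right end of the interval. *)
    by move=> l l0 _; exact: interior_line_search_ray lmin ltlmax l0.
  split; first by move=> v /=; rewrite in_fsetD1 => /andP[_ vS]; exact: SV.
  right; split.
  - by rewrite [in RHS](cardfsD1 a) aS addnC.
  - case: lmin => /=; rewrite in_itv/= => /andP[lt0 ltc] /(_ 0).
    by rewrite /= in_itv/= lexx (le_trans lt0 ltc) scale0r subr0; apply.
  - move=> S1; move: gapas; suff -> : a = s by rewrite dotBr subrr.
    move: S1; rewrite (cardfsD1 a) aS (cardfsD1 s) in_fsetD1 sS andbT.
    by case: (eqVneq s a).
split.
  move=> v /=; case: ifP => _; first by rewrite in_fset1 => /eqP ->.
  by rewrite in_fset1U => /orP[/eqP ->//|]; exact: SV.
left; split.
  case: ifP => _; first by rewrite cardfs1 addnC.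
  by rewrite cardfsU1 addnC leq_add2l leq_b1.
apply: (@quadratic_progressP x _ x w) => //; first exact: V_sub_P.
case: lmin => _ lmin l l0 l1; apply: lmin.
by rewrite /= in_itv/= l0.
Qed.

Lemma gap_ge0 x : P x -> 0 <= gap x.
Proof. by case: xstar_min => _ h /h; rewrite subr_ge0. Qed.

End BPCGProgress.

(** * The convergence rate *)

Theorem theorem3p1 (R : realType) (d : nat) (P V : set 'rV[R]_d)
    (f : 'rV[R]_d -> R) (L : R) (xstar : 'rV[R]_d) (T : nat)
    (x : nat -> 'rV[R]_d) (S_ : nat -> {fset 'rV[R]_d})
    (c : nat -> 'rV[R]_d -> R)
    (P_compact : compact P)
    (P_convex : convex_set P)
    (V_sub_P : V `<=` P)
    (P_hull : P = convex_hull V)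
    (f_diff : forall y, differentiable f y)
    (f_convex : convex_function [set: 'rV[R]_d] f)
    (f_smooth : smooth_with L f)
    (xstar_min : argmin_set P f xstar)
    (T_ge1 : (1 <= T)%N)
    (x_in_P : forall i, (i <= T)%N -> P (x i))
    (x_run : bpcg_run V f T x S_ c) :
  f (x T) - f xstar <= 4 * L * diameter P ^+ 2 / T%:R.
Proof.
case: (x_run) => Vx0 S0 _ step.
pose C := L * diameter P ^+ 2.
pose h t := f (x t) - f xstar.
pose m t := (t + #|` S_ t| + 5)%N.
have stepP := bpcg_step_progress P_compact V_sub_P P_hull f_diff f_convex
  f_smooth xstar_min.
have h0 t : (t <= T)%N -> 0 <= h t by move=> /x_in_P; exact: gap_ge0.
have SV t : (t <= T)%N -> [set` S_ t] `<=` V.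
  elim: t => [_|t IH tT].
    by rewrite S0 => v /=; rewrite in_fset1 => /eqP ->.
  by have [] := stepP _ _ _ _ _ _ (x_in_P _ (ltnW tT)) (IH (ltnW tT))
    (step t tT).
have C0 : 0 <= C.
  apply: le_trans (smooth_diameter_bound f_convex f_diff f_smooth P_compact
    (V_sub_P _ Vx0) (V_sub_P _ Vx0)).
  exact: smooth_convex_enorm _ f_convex f_diff f_smooth.
have inv t : (t < T)%N -> (m t.+1)%:R * h t.+1 <= 4 * C.
  elim: t => [T1|t IH tT].
    have [_] := stepP _ _ _ _ _ _ (x_in_P _ (ltnW T1))
      (SV _ (ltnW T1)) (step _ T1).
    (* The initial gap has no bound in terms of C: the step length l = 1
       eliminates it. *)
    rewrite S0 cardfs1 => S1.
    have {S1} [S1 h1] : (#|` S_ 1| <= 2)%N /\ h 1%N <= C / 2.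
      case: S1 => [[S1 /(_ 1 ler01 (lexx _))]|[S1 f1 /(_ isT) gap0]].
        by rewrite /h -/C; split=> //; lra.
      by split; [lia|rewrite /h; lra].
    have : (m 1%N)%:R <= 8 :> R by rewrite ler_nat /m; lia.
    by move=> /(ler_wpM2r (h0 _ T1)); lra.
  have {}IH := IH (ltnW tT).
  have [_ []] := stepP _ _ _ _ _ _ (x_in_P _ (ltnW tT))
    (SV _ (ltnW tT)) (step _ tT).
    move=> [S' /(_ (4 / (m t.+1)%:R))].
    have m4 : 4 <= (m t.+1)%:R :> R by rewrite ler_nat /m; lia.
    rewrite divr_ge0// ler_pdivrMr ?mul1r; last by lra.
    move=> /(_ isT m4); apply: harmonic_recurrence => //.
    - by rewrite -natrD ler_nat /m; lia.
    - exact: h0.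
  (* Drop step: the time gained offsets the vertex lost, so m is constant. *)
  move=> [S' f' _]; apply: le_trans IH.
  rewrite (_ : m t.+2 = m t.+1); last by rewrite /m; lia.
  by rewrite ler_wpM2l// lerD2r.
have := inv T.-1; rewrite prednK// => /(_ (leqnn _)) mh.
rewrite ler_pdivlMr ?ltr0n// -mulrA -/C.
apply: le_trans mh; rewrite mulrC; apply: ler_wpM2r; first exact: h0.
by rewrite ler_nat /m -addnA leq_addr.
Qed.
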